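(* Let $\Lambda(f)$ be the envelope class defined by a function $f$ that is ultimately monotonically non-increasing, and suppose the envelope is Fréchet with index $\gamma>0$, i.e. the smoothed envelope distribution $F$ belongs to $\mathrm{MDA}(\gamma)$. Let $m_n$ be the solution $x$ of $\overline F(x)=x/n$. Then there is a constant $\kappa_\gamma>0$ such that for all sufficiently large $n$, $$R^+(\Lambda_n)\ge \kappa_\gamma\, m_n .$$
   Context: Envelope classes: for $f:\mathbb N_+\to(0,1]$ with $1<\sum_j f(j)<\infty$, $\Lambda(f)$ is the set of stationary memoryless (i.i.d.) sources on $\mathbb N_+$ with marginal $\mathbb P_1\{j\}\le f(j)$ for all $j$; $\Lambda_n$ is the set of their restrictions to $n$ symbols. The envelope distribution is $F(k)=1-\sum_{j>k}f(j)$ when this sum is $<1$, else $0$; a smoothed envelope distribution (still denoted $F$) is a c.d.f. on $\mathbb R_+$ coinciding with $F$ on $\mathbb N$ with continuous derivative, positive wherever $F(\lfloor x\rfloor)\in(0,1)$. $\overline F=1-F$, $U(t)=\overline F^{-1}(1/t)$, and $F\in\mathrm{MDA}(\gamma)$ means there are $A_n>0$ with $F^n(A_nx+U(n))\to\exp(-(1+\gamma x)^{-1/\gamma})$ for all $x$ with $1+\gamma x>0$. The minimax redundancy is $R^+(\Lambda_n)=\inf_{Q_n}\sup_{\mathbb P\in\Lambda}D(\mathbb P_n,Q_n)$, the infimum over probability distributions $Q_n$ on $\mathbb N_+^n$, with $D$ the Kullback–Leibler divergence in bits. *)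

(* Defs.v *)
From HB Require Import structures.
From mathcomp Require Import all_boot all_order all_algebra.
From mathcomp Require Import all_classical all_reals all_analysis.
Set Implicit Arguments. Unset Strict Implicit. Unset Printing Implicit Defensive.
Import Order.TTheory GRing.Theory Num.Theory.
Import numFieldNormedType.Exports.
Local Open Scope classical_set_scope.
Local Open Scope ring_scope.

Section Defs.
Variable R : realType.

Definition Npos : set nat := [set j | (0 < j)%N].

(* f : N_+ -> (0,1] with 1 < sum_j f(j) < oo (the value f 0 is irrelevant). *)
Definition envelope_fun (f : nat -> R) : Prop :=
  (forall j, (0 < j)%N -> 0 < f j <= 1) /\
  (1%:E < \esum_(j in Npos) (f j)%:E)%E /\
  (\esum_(j in Npos) (f j)%:E < +oo)%E.

Definition ultimately_nonincreasing (f : nat -> R) : Prop :=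
  exists J : nat, forall j, (J <= j)%N -> f j.+1 <= f j.

Definition envF (f : nat -> R) (k : nat) : R :=
  let s := fine (\esum_(j in [set j | (k < j)%N]) (f j)%:E) in
  if s < 1 then 1 - s else 0.

Definition smoothed_envelope (f : nat -> R) (F : R -> R) : Prop :=
  (forall x, x < 0 -> F x = 0) /\
  {homo F : x y / x <= y} /\
  (forall x0, F x @[x --> x0^'+] --> F x0) /\
  (F x @[x --> +oo] --> (1 : R)) /\
  (forall k : nat, F k%:R = envF f k) /\
  (forall x, 0 < x -> derivable F x 1 /\ {for x, continuous (derive1 F)}) /\
  (forall x, 0 < x -> 0 < F (Num.floor x)%:~R < 1 -> 0 < derive1 F x).

Definition Fbar (F : R -> R) (x : R) : R := 1 - F x.

(* U(t) = Fbar^{-1}(1/t), as the generalized (left-continuous) inverse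
   inf {x | F x >= 1 - 1/t}. *)
Definition Uq (F : R -> R) (t : R) : R := inf [set x | 1 - t^-1 <= F x].

(* F in MDA(gamma), for gamma > 0 (the gamma <> 0 form of the GEV limit). *)
Definition MDA (gamma : R) (F : R -> R) : Prop :=
  exists A : nat -> R, (forall n, 0 < A n) /\
    forall x, 0 < 1 + gamma * x ->
      (fun n : nat => F (A n * x + Uq F n%:R) ^+ n) @ \oo -->
        expR (- ((1 + gamma * x) `^ (- gamma^-1))).

(* Marginals of the sources in Lambda(f): probability distributions on N_+
   dominated by f. *)
Definition in_Lambda (f : nat -> R) (p : nat -> R) : Prop :=
  (forall j, 0 <= p j) /\ p 0%N = 0 /\
  (\esum_(j in [set: nat]) (p j)%:E = 1%:E)%E /\
  (forall j, (0 < j)%N -> p j <= f j).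

Definition Pn (n : nat) (p : nat -> R) (x : n.-tuple nat) : R :=
  \prod_(i < n) p (tnth x i).

Definition dist_n (n : nat) (Q : n.-tuple nat -> R) : Prop :=
  (forall x, 0 <= Q x) /\
  (forall x, (exists i : 'I_n, tnth x i = 0%N) -> Q x = 0) /\
  (\esum_(x in [set: n.-tuple nat]) (Q x)%:E = 1%:E)%E.

Definition klterm (a b : R) : \bar R :=
  if a == 0 then 0%E else if b == 0 then +oo%E else (a * ln (a / b))%:E.

(* Kullback-Leibler divergence in bits: sum of the (extended) series
   sum_x P(x) log2 (P(x)/Q(x)), computed as positive part minus negative part. *)
Definition KL (n : nat) (P Q : n.-tuple nat -> R) : \bar R :=
  ((\esum_(x in [set: n.-tuple nat]) maxe (klterm (P x) (Q x)) 0%E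
    - \esum_(x in [set: n.-tuple nat]) maxe (- klterm (P x) (Q x)) 0%E)
   * ((ln 2)^-1)%:E)%E.

Definition minimax_redundancy (f : nat -> R) (n : nat) : \bar R :=
  ereal_inf [set ereal_sup [set @KL n (@Pn n p) Q | p in in_Lambda f] | Q in @dist_n n].

End Defs.

(* Main.v *)
Require Import Defs.
From HB Require Import structures.
From mathcomp Require Import all_boot all_order all_algebra.
From mathcomp Require Import all_classical all_reals all_analysis.
From mathcomp Require Import ring lra zify.
Set Implicit Arguments.
Unset Strict Implicit.
Unset Printing Implicit Defensive.
Import Order.TTheory GRing.Theory Num.Theory.
Import numFieldNormedType.Exports.
Local Open Scope classical_set_scope.
Local Open Scope ring_scope.

(**
The extreme-value condition makes [Fbar F (lam * x) <= q * Fbar F x] for large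
[x], with [lam > 1] and [q < 1] depending only on [gamma].  As
[Fbar F (m n) = m n / n], the monotone envelope [f] is then at least [c / n] on
all symbols between a constant [K] and [m n].  Split these symbols into
[k >= m n / 4] pairs and consider the [2 ^ k] sources that put mass [w = c / n]
on one symbol of each pair and share the same remaining law on [1, ..., K].  A
pair seen in the sample reveals one bit of the parameter, so under the uniform
prior the sample carries [k * (1 - (1 - w) ^ n) >= k * (1 - exp (- c))] bits of
information, and the minimax redundancy is at least that.
*)

(** * Sums of non-negative terms carried by a finite set *)

Lemma esum_finType (R : realType) (I : finType) (a : I -> \bar R) :
  (forall i, (0 <= a i)%E) -> (\esum_(i in [set: I]) a i = \sum_i a i)%E.
Proof.
move=> a0; rewrite esum_fset//; last exact: finite_finset.
rewrite (fsbigE (index_enum I)) ?index_enum_uniq//.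
  by apply: eq_bigl => i; exact: mem_set.
by move=> i _; rewrite mem_index_enum.
Qed.

Lemma sum_injective_le_esum (R : realType) (I : finType) (T : choiceType)
    (h : I -> T) (a : T -> \bar R) :
  injective h -> (forall y, (0 <= a y)%E) ->
  (\sum_i a (h i) <= \esum_(y in [set: T]) a y)%E.
Proof.
move=> hinj a0.
rewrite (esumID (range h))//.
have -> : (\sum_i a (h i) = \esum_(y in [set: T] `&` range h) a y)%E.
  rewrite setTI esum_image; last by move=> x y _ _ /hinj.
  by rewrite esum_finType.
by rewrite leeDl// esum_ge0.
Qed.

Lemma esum_injective (R : realType) (I : finType) (T : choiceType)
    (h : I -> T) (a : T -> \bar R) :
  injective h -> (forall y, (0 <= a y)%E) ->
  (forall y, ~ range h y -> a y = 0%E) ->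
  (\esum_(y in [set: T]) a y = \sum_i a (h i))%E.
Proof.
move=> hinj a0 aout.
rewrite (esumID (range h))// [X in (_ + X)%E]esum1; last first.
  by move=> y [_ /aout].
rewrite adde0 setTI esum_image; last by move=> x y _ _ /hinj.
by rewrite esum_finType.
Qed.

(** * Divergence bounded below through a finite reference measure *)

(* [M] plays the part of a reference measure: [ln (M / Q) >= 1 - Q / M]. *)
Lemma klterm_ge (R : realType) (a b M : R) :
  0 <= a -> 0 <= b -> 0 <= M -> (M = 0 -> a = 0) ->
  exists N : R, (maxe (- klterm a b) 0 = N%:E)%E /\
    ((a * (ln (a / M) + 1 - b / M) + N)%:E <= maxe (klterm a b) 0)%E.
Proof.
move=> a0 b0 M0 aM; rewrite /klterm.
have [->|an0] := eqVneq a 0.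
  by exists 0; rewrite mul0r addr0 oppe0 maxxx.
have [->|bn0] := eqVneq b 0.
  exists 0; split; first by rewrite max_r ?leNye.
  by rewrite max_l ?leey.
have ap : 0 < a by rewrite lt_neqAle eq_sym an0.
have bp : 0 < b by rewrite lt_neqAle eq_sym bn0.
have Mp : 0 < M.
  by rewrite lt_neqAle M0 andbT eq_sym; apply: contra_neq an0.
exists (Num.max (- (a * ln (a / b))) 0); split.
  by rewrite -EFinN -EFin_max.
rewrite -EFin_max lee_fin.
have -> : Num.max (a * ln (a / b)) 0 =
    a * ln (a / b) + Num.max (- (a * ln (a / b))) 0.
  by rewrite addr_maxr subrr addr0 maxC.
rewrite lerD2r ler_wpM2l//.
have := @le_ln1Dx _ (b / M - 1).
rewrite ltrBrDr addrC subrr divr_gt0// => /(_ isT).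
rewrite addrC subrK !ln_div ?posrE//.
lra.
Qed.

(** The negative parts are finite and carried by the range of [h], so no indeterminate difference
    arises and the [N] of [klterm_ge] cancels term by term. *)
Lemma KL_ge_finite (R : realType) n (I : finType) (h : I -> n.-tuple nat)
    (P Q : n.-tuple nat -> R) (M : I -> R) :
  injective h -> (forall y, 0 <= P y) -> (forall y, 0 <= Q y) ->
  (forall y, ~ range h y -> P y = 0) ->
  (forall i, 0 <= M i) -> (forall i, M i = 0 -> P (h i) = 0) ->
  (((\sum_i P (h i) * (ln (P (h i) / M i) + 1 - Q (h i) / M i)) / ln 2)%:E
    <= KL P Q)%E.
Proof.
move=> hinj P0 Q0 Pout M0 PM; rewrite /KL EFinM.
apply: lee_wpmul2r; first by rewrite lee_fin invr_ge0 ln_ge0// ler1n.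
have max0 (x : \bar R) : (0 <= maxe x 0)%E by rewrite le_max lexx orbT.
have [N HN] := choice (fun i => klterm_ge (P0 (h i)) (Q0 (h i)) (M0 i) (@PM i)).
rewrite [X in (_ - X)%E](esum_injective hinj)//; last first.
  by move=> y /Pout ->; rewrite /klterm eqxx oppe0 maxxx.
under [X in (_ - X)%E]eq_bigr => i _ do rewrite (HN i).1.
rewrite sumEFin leeBrDr//.
apply: le_trans (sum_injective_le_esum hinj _) => //.
rewrite -EFinD -big_split/= -sumEFin.
by apply: lee_sum => i _; exact: (HN i).2.
Qed.

(** * The cube of sources and the information in a sample *)

Lemma sum_prod_ffun (R : realType) (A : finType) n (q : A -> R) :
  \sum_(x : {ffun 'I_n -> A}) \prod_t q (x t) = (\sum_a q a) ^+ n.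
Proof.
by rewrite -(bigA_distr_bigA (fun=> q)) prodr_const card_ord.
Qed.

Section Cube.
Variables (R : realType) (K k : nat) (p0 : 'I_K -> R) (w : R).
Hypotheses (p0_ge0 : forall j, 0 <= p0 j) (w_ge0 : 0 <= w).
Hypothesis mass1 : \sum_j p0 j + k%:R * w = 1.

Let A : finType := ('I_K + 'I_k * bool)%type.
Let Theta : finType := {ffun 'I_k -> bool}.

(* The source of parameter [theta] puts mass [w] on exactly one of the two
   symbols [(i, true)], [(i, false)] of each pair [i]. *)
Definition cube_law (theta : {ffun 'I_k -> bool})
    (a : 'I_K + 'I_k * bool) : R :=
  match a with inl j => p0 j | inr (i, b) => (theta i == b)%:R * w end.

Definition cube_env (a : 'I_K + 'I_k * bool) : R :=
  match a with inl j => p0 j | inr _ => w end.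

Definition in_pair (i : 'I_k) (a : 'I_K + 'I_k * bool) : bool :=
  match a with inl _ => false | inr (i', _) => i' == i end.

Definition seen n (x : {ffun 'I_n -> 'I_K + 'I_k * bool}) : {set 'I_k} :=
  [set i | [exists t, in_pair i (x t)]].

(** A closed form dominating the uniform mixture of the product laws: a sample is compatible with at
    most [2 ^ (k - #|seen x|)] parameters. Unlike the mixture, it need not vanish on samples that
    show both symbols of a pair. *)
Definition cube_ref n (x : {ffun 'I_n -> 'I_K + 'I_k * bool}) : R :=
  \prod_t cube_env (x t) * 2^-1 ^+ #|seen x|.

Lemma cube_law_ge0 theta a : 0 <= cube_law theta a.
Proof. by case: a => [j|[i b]] //=; rewrite mulr_ge0. Qed.

Lemma cube_law_le_env theta a : cube_law theta a <= cube_env a.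
Proof. by case: a => [j|[i b]] //=; case: eqP => _; rewrite ?mul1r ?mul0r. Qed.

Lemma cube_env_ge0 a : 0 <= cube_env a.
Proof. by case: a. Qed.

Lemma cube_ref_ge0 n (x : {ffun 'I_n -> A}) : 0 <= cube_ref x.
Proof.
rewrite mulr_ge0 ?exprn_ge0// prodr_ge0// => t _; exact: cube_env_ge0.
Qed.

Lemma sum_cube_law theta (v : A -> R) : \sum_a cube_law theta a * v a =
  \sum_j p0 j * v (inl j) + w * \sum_i v (inr (i, theta i)).
Proof.
rewrite big_sumType/=; congr (_ + _); rewrite mulr_sumr.
transitivity (\sum_i \sum_b (theta i == b)%:R * w * v (inr (i, b))).
  by rewrite pair_bigA; apply: eq_bigr => -[i b].
apply: eq_bigr => i _; rewrite (bigD1 (theta i))//= eqxx mul1r big1 ?addr0//.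
by move=> b; rewrite eq_sym => /negbTE ->; rewrite !mul0r.
Qed.

Lemma sum_cube_law1 theta : \sum_a cube_law theta a = 1.
Proof.
under eq_bigr => a _ do rewrite -[cube_law _ _]mulr1.
rewrite (sum_cube_law theta (fun=> 1)) sumr_const card_ord mulrC -[RHS]mass1.
by under eq_bigr => j _ do rewrite mulr1.
Qed.

Lemma sum_cube_law_notin_pair theta i :
  \sum_a cube_law theta a * (~~ in_pair i a)%:R = 1 - w.
Proof.
rewrite sum_cube_law/= -[in RHS]mass1.
rewrite [X in _ + w * X](_ : _ = k%:R - 1).
  under eq_bigr => j _ do rewrite mulr1.
  by rewrite mulrBr mulr1 mulrC addrA.
rewrite (bigD1 i)//= eqxx add0r.
under eq_bigr => j /negbTE -> do [].
rewrite sumr_const cardC1 card_ord; case: k i => [[]//|k' _].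
by rewrite -natr1 addrK.
Qed.

(* A pair is missed by [n] draws with probability [(1 - w) ^+ n]. *)
Lemma expected_seen n theta :
  \sum_(x : {ffun 'I_n -> A}) (\prod_t cube_law theta (x t)) * #|seen x|%:R
  = k%:R * (1 - (1 - w) ^+ n).
Proof.
have seenE (x : {ffun 'I_n -> A}) : #|seen x|%:R =
    \sum_(i : 'I_k) (1 - \prod_t (~~ in_pair i (x t))%:R) :> R.
  rewrite -sum1_card natr_sum [LHS]big_mkcond; apply: eq_bigr => i _.
  rewrite inE; case: ifPn => [/existsP[t xt]|/existsPn xt].
    by rewrite (bigD1 t)//= xt mul0r subr0.
  by rewrite big1 ?subrr// => t _; rewrite xt.
under eq_bigr => x _ do rewrite seenE mulr_sumr.
rewrite exchange_big/= mulr_natl -[in RHS](card_ord k) -sumr_const.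
apply: eq_bigr => i _.
under eq_bigr => x _ do rewrite mulrBr mulr1 -big_split/=.
rewrite sumrB sum_prod_ffun sum_cube_law1 expr1n; congr (_ - _).
rewrite (sum_prod_ffun n (fun a => cube_law theta a * (~~ in_pair i a)%:R)).
by rewrite sum_cube_law_notin_pair.
Qed.

Lemma cube_law_prod_env n (x : {ffun 'I_n -> A}) theta :
  \prod_t cube_law theta (x t) != 0 ->
  \prod_t cube_law theta (x t) = \prod_t cube_env (x t).
Proof.
move=> /prodf_neq0 x0; apply: eq_bigr => t _; have := x0 t isT.
case: (x t) => [j|[i b]] //=.
by case: (theta i == b); rewrite ?mul1r// mul0r eqxx.
Qed.

(* A sample can only have come from the [theta] that agree with it on the pairs
   it has seen. *)
Lemma sum_theta_cube_law n (x : {ffun 'I_n -> A}) :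
  \sum_(theta : Theta) \prod_t cube_law theta (x t) <= 2 ^+ k * cube_ref x.
Proof.
(* [c i b] indicates that the sample does not contradict [theta i = b]; the bound then factors over
   the pairs and can be summed over [theta] coordinatewise. *)
pose c i b : R := (~~ [exists t, x t == inr (i, ~~ b)])%:R.
have step theta : \prod_t cube_law theta (x t) <=
    (\prod_t cube_env (x t)) * \prod_i c i (theta i).
  have [->|x0] := eqVneq (\prod_t cube_law theta (x t)) 0.
    by rewrite mulr_ge0// prodr_ge0// => t _; exact: cube_env_ge0.
  suff -> : \prod_i c i (theta i) = 1 by rewrite mulr1 (cube_law_prod_env x0).
  apply: big1 => i _; rewrite /c.
  case: existsP => // -[t /eqP xt]; move/prodf_neq0 : x0 => /(_ t isT).
  by rewrite xt/=; case: (theta i); rewrite mul0r eqxx.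
apply: le_trans (ler_sum _ (fun theta _ => step theta)) _.
rewrite -mulr_sumr -(bigA_distr_bigA c) /cube_ref mulrCA.
apply: ler_wpM2l; first by rewrite prodr_ge0// => t _; exact: cube_env_ge0.
have -> : 2 ^+ k * 2^-1 ^+ #|seen x| =
    \prod_(i < k) (2 * (if i \in seen x then 2^-1 else 1)) :> R.
  by rewrite big_split/= prodr_const card_ord -big_mkcond prodr_const.
apply: ler_prod => i _; rewrite big_bool/= addr_ge0//=.
rewrite inE; case: ifPn => [/existsP[t]|_]; last first.
  by rewrite mulr1 lerD// /c; case: [exists _, _].
(* A seen symbol of pair [i] rules out one of the two values of [theta i]. *)
rewrite divff// /c; case xt: (x t) => [//|[i' b]] /= /eqP <-.
have : [exists t, x t == inr (i', b)] by apply/existsP; exists t; rewrite xt.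
by case: b {xt} => /= ->; rewrite ?add0r ?addr0 lern1 leq_b1.
Qed.

(** Supplies absolute continuity: a sample with zero reference weight is impossible under every
    [theta]. *)
Lemma cube_law_le_ref n (x : {ffun 'I_n -> A}) theta :
  \prod_t cube_law theta (x t) <= 2 ^+ k * cube_ref x.
Proof.
apply: le_trans (sum_theta_cube_law x).
rewrite (bigD1 theta)//= lerDl sumr_ge0// => th _.
by rewrite prodr_ge0// => t _; exact: cube_law_ge0.
Qed.

(** On the support of a law its factors equal those of [cube_env], so the likelihood ratio is
    exactly [2 ^+ #|seen x|]: one bit per seen pair. *)
Lemma cube_law_ln n (x : {ffun 'I_n -> A}) theta :
  \prod_t cube_law theta (x t) *
    ln (\prod_t cube_law theta (x t) / cube_ref x) =
  \prod_t cube_law theta (x t) * #|seen x|%:R * ln 2.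
Proof.
have [->|x0] := eqVneq (\prod_t cube_law theta (x t)) 0.
  by rewrite !mul0r.
rewrite -mulrA; congr (_ * _).
rewrite /cube_ref -(cube_law_prod_env x0) invfM mulrA divff// mul1r.
by rewrite -exprVn invrK lnXn// mulr_natl.
Qed.

(* Summing over [theta] replaces the likelihoods by at most [2 ^+ k * cube_ref],
   so that the terms in [Q] cost no more than the total mass [1] of [Q]. *)
Lemma exists_theta n (Q : {ffun 'I_n -> A} -> R) :
  (forall x, 0 <= Q x) -> \sum_x Q x <= 1 ->
  exists theta : Theta, k%:R * (1 - (1 - w) ^+ n) * ln 2 <=
    \sum_(x : {ffun 'I_n -> A}) \prod_t cube_law theta (x t) *
      (ln (\prod_t cube_law theta (x t) / cube_ref x) + 1 - Q x / cube_ref x).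
Proof.
move=> Q0 Q1; set D := k%:R * _ * _.
pose l (theta : Theta) := \sum_(x : {ffun 'I_n -> A})
  \prod_t cube_law theta (x t) *
    (ln (\prod_t cube_law theta (x t) / cube_ref x) + 1 - Q x / cube_ref x).
rewrite -/(exists theta, D <= l theta).
(* If every [theta] fell short of [D], so would the average over the cube. *)
apply/existsP; rewrite -[X in is_true X]negbK; apply/negP => /existsPn lD.
have : \sum_theta l theta < \sum_(theta : Theta) D.
  apply: ltr_sum => [|theta _]; last by rewrite ltNge lD.
  by apply/hasP; exists [ffun=> true] => //; rewrite mem_index_enum.
rewrite ltNge => /negP; apply.
rewrite sumr_const card_ffun card_bool card_ord.
have -> : \sum_theta l theta = D *+ 2 ^ k + 1 *+ 2 ^ k -
    \sum_(x : {ffun 'I_n -> A})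
      (\sum_(theta : Theta) \prod_t cube_law theta (x t)) *
      (Q x / cube_ref x).
  under [X in _ - X]eq_bigr => x _ do rewrite mulr_suml.
  rewrite [X in _ - X]exchange_big/=.
  have -> : (2 ^ k)%N = #|Theta| by rewrite card_ffun card_bool card_ord.
  rewrite -!sumr_const -big_split/= -sumrB; apply: eq_bigr => theta _.
  rewrite /l; under [LHS]eq_bigr => x _ do
    rewrite mulrBr mulrDr mulr1 cube_law_ln.
  rewrite sumrB big_split/= -mulr_suml expected_seen sum_prod_ffun.
  by rewrite sum_cube_law1 expr1n.
rewrite -addrA lerDl subr_ge0.
apply: (@le_trans _ _ (\sum_x 2 ^+ k * Q x)).
  apply: ler_sum => x _.
  (* Division by zero yields 0, so such samples contribute nothing on the left. *)
  have [r0|r0] := eqVneq (cube_ref x) 0.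
    by rewrite r0 invr0 mulr0 mulr0 mulr_ge0 ?exprn_ge0.
  rewrite mulrCA [X in _ <= X]mulrC ler_wpM2l//.
  rewrite ler_pdivrMr ?sum_theta_cube_law//.
  by rewrite lt_neqAle eq_sym r0 cube_ref_ge0.
by rewrite -mulr_sumr -natrX ler_piMr.
Qed.

End Cube.

(** * From the cube to the envelope class *)

(** The injection [phi] transports the cube into the class; for each [Q], [exists_theta] then
    selects a source that is costly for it. *)
Lemma minimax_redundancy_ge_cube (R : realType) (f : nat -> R) (K k n : nat)
    (p0 : 'I_K -> R) (w : R) (phi : 'I_K + 'I_k * bool -> nat) :
  injective phi -> (forall a, 0 < phi a)%N ->
  (forall j, (0 < j)%N -> 0 <= f j) ->
  (forall j, 0 <= p0 j) -> 0 <= w -> \sum_j p0 j + k%:R * w = 1 ->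
  (forall a, cube_env p0 w a <= f (phi a)) ->
  ((k%:R * (1 - (1 - w) ^+ n))%:E <= minimax_redundancy f n)%E.
Proof.
move=> phi_inj phi_gt0 f_ge0 p0_ge0 w_ge0 mass1 env_le.
pose A : finType := ('I_K + 'I_k * bool)%type.
pose h (x : {ffun 'I_n -> A}) : n.-tuple nat := [tuple phi (x t) | t < n].
have h_inj : injective h.
  move=> x y hxy; apply/ffunP => t; apply: phi_inj.
  by have := congr1 (fun v => tnth v t) hxy; rewrite !tnth_mktuple.
pose p theta j := \sum_(a : A | phi a == j) cube_law p0 w theta a.
have p_phi theta a : p theta (phi a) = cube_law p0 w theta a.
  rewrite /p (bigD1 a)//= big1 ?addr0// => b /andP[/eqP /phi_inj -> /eqP].
  by [].
have p_out theta j : ~ range phi j -> p theta j = 0.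
  by move=> jout; apply: big1 => a /eqP aj; case: jout; exists a.
have p_ge0 theta j : 0 <= p theta j.
  by apply: sumr_ge0 => a _; exact: cube_law_ge0.
have p_Lambda theta : in_Lambda f (p theta).
  split; [exact: p_ge0|split; [|split]].
  - by apply: p_out => -[a _ a0]; have := phi_gt0 a; rewrite a0.
  - rewrite (esum_injective phi_inj).
    + under eq_bigr => a _ do rewrite p_phi.
      by rewrite sumEFin sum_cube_law1.
    + by move=> j; rewrite lee_fin.
    + by move=> j /p_out ->.
  - move=> j j_gt0; have [[a _ <-]|/p_out ->] := pselect (range phi j).
      by rewrite p_phi; apply: le_trans (env_le a); exact: cube_law_le_env.
    exact: f_ge0.
have P_h theta x : Pn (p theta) (h x) = \prod_t cube_law p0 w theta (x t).
  by apply: eq_bigr => t _; rewrite tnth_mktuple p_phi.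
have P_out theta y : ~ range h y -> Pn (p theta) y = 0.
  move=> yout; apply/eqP/negPn/negP => /prodf_neq0 y0; apply: yout.
  have ex t : exists a, phi a = tnth y t.
    have [[a _ at_]|/p_out pt] := pselect (range phi (tnth y t)).
      by exists a.
    by have := y0 t isT; rewrite pt eqxx.
  have [x xP] := choice ex.
  exists [ffun t => x t] => //; apply: eq_from_tnth => t.
  by rewrite tnth_mktuple ffunE xP.
apply: le_ereal_inf_tmp => _ [Q [Q_ge0 [_ Q1]] <-].
(* [Q] may also charge words outside the image of [h], hence only an inequality. *)
have Qh1 : \sum_x Q (h x) <= 1.
  rewrite -lee_fin -sumEFin -Q1.
  apply: (sum_injective_le_esum (a := fun y => (Q y)%:E) h_inj) => y.
  by rewrite lee_fin.
have [theta Htheta] :=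
  exists_theta p0_ge0 w_ge0 mass1 (fun x => Q_ge0 (h x)) Qh1.
apply: (@le_trans _ _ (KL (Pn (p theta)) Q)); last first.
  by apply: ereal_sup_ubound; exists (p theta).
apply: le_trans
  (KL_ge_finite (M := @cube_ref _ _ _ p0 w n) h_inj _ Q_ge0 _ _ _).
- rewrite lee_fin ler_pdivlMr ?ln_gt0 ?ltr1n//.
  apply: le_trans Htheta _; rewrite le_eqVlt; apply/orP; left; apply/eqP.
  by apply: eq_bigr => x _; rewrite P_h.
- by move=> y; apply: prodr_ge0 => t _; exact: p_ge0.
- exact: P_out.
- by move=> x; exact: cube_ref_ge0.
- move=> x ref0; apply/eqP; rewrite eq_le P_h.
  have := cube_law_le_ref p0_ge0 w_ge0 x theta; rewrite ref0 mulr0 => ->.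
  by apply: prodr_ge0 => t _; exact: cube_law_ge0.
Qed.

(** The pairs are consecutive symbols after [K]. The mass they leave goes to the first [K] symbols
    in proportion to [f], with a factor at most 1 because [f] sums to at least 1 there. *)
Lemma minimax_redundancy_ge_block (R : realType) (f : nat -> R) (K k n : nat)
    (w : R) :
  (forall j, (0 < j)%N -> 0 <= f j) -> 1 <= \sum_(j < K) f j.+1 ->
  0 <= w -> k%:R * w <= 1 ->
  (forall j, (K < j <= K + k.*2)%N -> w <= f j) ->
  ((k%:R * (1 - (1 - w) ^+ n))%:E <= minimax_redundancy f n)%E.
Proof.
move=> f_ge0 S_ge1 w_ge0 kw_le1 w_le.
pose phi (a : 'I_K + 'I_k * bool) : nat :=
  match a with inl j => j.+1 | inr (i, b) => (K + i.*2 + b).+1 end.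
set S := \sum_(j < K) _ in S_ge1.
have S_gt0 : 0 < S by rewrite (lt_le_trans ltr01).
apply: (@minimax_redundancy_ge_cube _ f K k n
  (fun j => f j.+1 * ((1 - k%:R * w) / S)) w phi) => //.
- move=> [j|[i b]] [j'|[i' b']] /= => [[/val_inj ->]//|||].
  + by move=> jE; have := ltn_ord j; lia.
  + by move=> jE; have := ltn_ord j'; lia.
  + move=> ibE; have eq_i : i = i' by apply: val_inj => /=; lia.
    by congr (inr (_, _)) => //; lia.
- by case=> [j|[i b]].
- by move=> j; rewrite mulr_ge0 ?f_ge0// divr_ge0 ?subr_ge0// ltW.
- by rewrite -mulr_suml -/S mulrCA divff ?gt_eqF// mulr1 subrK.
- case=> [j|[i b]] /=; last by apply: w_le; have := ltn_ord i; lia.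
  rewrite ler_piMr ?f_ge0// ler_pdivrMr// mul1r.
  by apply: le_trans S_ge1; rewrite gerBl mulr_ge0.
Qed.

(** * The envelope distribution and its increments *)

Section Envelope.
Variables (R : realType) (f : nat -> R).
Hypothesis env : envelope_fun f.

Let f_gt0 j : (0 < j)%N -> 0 < f j.
Proof. by move=> /env.1/andP[]. Qed.

(** Were all partial sums below 1, the full sum could not exceed 1. *)
Lemma envelope_sum_ge1 : exists K0, forall K, (K0 <= K)%N ->
  1 <= \sum_(j < K) f j.+1.
Proof.
suff [K0 S1] : exists K0, 1 <= \sum_(j < K0) f j.+1.
  exists K0 => K K0K; apply: le_trans S1 _.
  rewrite -!(big_mkord xpredT (fun j => f j.+1)).
  rewrite [X in _ <= X](@big_cat_nat _ _ _ K0)//=.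
  by rewrite lerDl sumr_ge0// => j _; exact/ltW/f_gt0.
apply: contrapT => /forallNP S1.
have := env.2.1; rewrite ltNge => /negP; apply.
rewrite /Npos.
rewrite -(@nneseries_esum _ (fun j => (f j)%:E) (fun j => 0 < j)%N); last first.
  by move=> j j0; rewrite lee_fin ltW// f_gt0.
apply: lime_le.
  by apply: is_cvg_nneseries_cond => j _ j0; rewrite lee_fin ltW// f_gt0.
apply: nearW => -[|K]; first by rewrite big_nil lee_fin.
rewrite big_ltn_cond//= big_add1/= sumEFin lee_fin big_mkord.
by have /negP := S1 K; rewrite -ltNge => /ltW.
Qed.

Let tail k : \bar R := (\esum_(j in [set j | (k < j)%N]) (f j)%:E)%E.

Let tail_ge0 k : (0 <= tail k)%E.
Proof.
apply: esum_ge0 => j kj.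
by rewrite lee_fin ltW// f_gt0// (leq_ltn_trans _ kj).
Qed.

Let tail_rec k : tail k = ((f k.+1)%:E + tail k.+1)%E.
Proof.
rewrite /tail (esumID [set k.+1]); last first.
  by move=> j kj; rewrite lee_fin ltW// f_gt0// (leq_ltn_trans _ kj).
rewrite (_ : _ `&` [set k.+1] = [set k.+1]); last first.
  by apply/seteqP; split => j /= => [[]//|->]; split.
rewrite esum_set1 ?lee_fin ?(ltW (f_gt0 _))//.
congr (_ + esum _ _)%E; apply/seteqP; split => j /=.
  by move=> [kj /eqP jk]; rewrite ltn_neqAle eq_sym jk.
by move=> kj; split; [exact: ltnW|move=> jk; rewrite jk ltnn in kj].
Qed.

Let tail_fin k : tail k \is a fin_num.
Proof.
rewrite ge0_fin_numE//; elim: k => [|k IHk]; first exact: env.2.2.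
by apply: le_lt_trans IHk; rewrite (tail_rec k) leeDr// lee_fin ltW// f_gt0.
Qed.

Let fine_tail_rec k : fine (tail k) = f k.+1 + fine (tail k.+1).
Proof. by rewrite tail_rec fineD. Qed.

Lemma envF_lt1 k : envF f k < 1.
Proof.
rewrite /envF -/(tail k); case: ifP => // _.
rewrite ltrBlDr ltrDl fine_tail_rec ltr_pwDl ?f_gt0//.
exact: fine_ge0.
Qed.

(** Not an equality: where the tail sum crosses 1, the cut-off of [envF] at 0 can make the increment
    smaller. *)
Lemma envF_step k : envF f k.+1 - envF f k <= f k.+1.
Proof.
have f0 := f_gt0 (ltn0Sn k).
rewrite /envF -/(tail k) -/(tail k.+1) (fine_tail_rec k).
by case: (ltP _ 1) => ?; case: (ltP _ 1) => ?; lra.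
Qed.

Lemma envF_increment_le a b : (a <= b)%N ->
  (forall j, (a < j)%N -> f j.+1 <= f j) ->
  envF f b - envF f a <= (b - a)%:R * f a.+1.
Proof.
move=> ab mono; rewrite -(subnKC ab) addKn; elim: (b - a)%N => [|d IHd].
  by rewrite addn0 subrr mul0r.
have fle : f (a + d).+1 <= f a.+1.
  elim: d {IHd} => [|d IHd]; first by rewrite addn0.
  by apply: le_trans IHd; rewrite addnS; apply: mono; rewrite ltnS leq_addr.
have := envF_step (a + d); rewrite addnS -natr1 mulrDl mul1r.
lra.
Qed.

End Envelope.

(** * Geometric decay of the tail under the extreme-value condition *)

(* Since [F] vanishes on negative reals, the limit at [x = -1/(2 gamma)] can
   only be positive if [A n <= 2 gamma (U n)]; with the limit at [x = 1] this
   bounds the tail at [(1 + 2 gamma) U n]. *)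
Lemma MDA_tail_contraction (R : realType) (gamma : R) : 0 < gamma ->
  exists2 q : R, 0 < q < 1 & forall F : R -> R,
    (forall x, x < 0 -> F x = 0) -> {homo F : x y / x <= y} ->
    (forall x, F x < 1) -> F x @[x --> +oo] --> (1 : R) -> MDA gamma F ->
    exists B : R, forall x, B <= x ->
      Fbar F ((1 + 2 * gamma) * x) <= q * Fbar F x.
Proof.
move=> gamma_gt0.
(* [expR (- tau)] is the limit at 1. As [tau < 1], there is room for [tau'], which absorbs the
   convergence, and for [q], which absorbs the rounding of [(Fbar F x)^-1] to an integer. *)
pose tau := (1 + gamma * 1) `^ (- gamma^-1).
have tau_gt0 : 0 < tau by rewrite powR_gt0// mulr1; lra.
have tau_lt1 : tau < 1.
  have p_gt0 : 0 < (1 + gamma) `^ gamma^-1 by rewrite powR_gt0//; lra.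
  rewrite /tau mulr1 powRN invf_lt1//.
  suff : 1 `^ gamma^-1 < (1 + gamma) `^ gamma^-1 by rewrite powR1.
  by apply: gt0_ltr_powR; rewrite ?invr_gt0 ?nnegrE//; lra.
pose tau' := (1 + tau) / 2; pose q := (1 + tau') / 2.
exists q; first by rewrite /q /tau'; lra.
move=> F Fneg Fhomo Flt1 F1 [A [A_gt0 HA]].
have F_ge0 x : 0 <= F x.
  have [/Fneg ->//|x0] := ltP x 0.
  by rewrite -(Fneg (-1)) ?Fhomo ?ltrN10//; lra.
have lim1 := HA 1 ltac:(lra).
have limN : 0 < 1 + gamma * (- (2 * gamma)^-1).
  suff -> : gamma * - (2 * gamma)^-1 = - 2^-1 by lra.
  by field; rewrite gt_eqF.
have {limN} lim2 := HA _ limN.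
have ev1 : \forall n \near \oo, expR (- tau') < F (A n * 1 + Uq F n%:R) ^+ n.
  by apply: (cvgr_gt _ lim1); rewrite ltr_expR -/tau /tau'; lra.
have ev2 : \forall n \near \oo,
    0 < F (A n * (- (2 * gamma)^-1) + Uq F n%:R) ^+ n.
  by apply: (cvgr_gt _ lim2); exact: expR_gt0.
have [N0 _ HN0] := filterI ev1 ev2.
(* The last bound gives [tau' / N <= q / N.+1] for [N >= N1]. *)
pose N1 := maxn 2 (maxn N0 (Num.truncn (2 * tau' / (1 - tau'))).+1).
have N1_gt0 : 0 < N1%:R :> R by rewrite ltr0n leq_max.
have [B0 [_ HB0]] : \forall x \near +oo, 1 - N1%:R^-1 < F x.
  by apply: (cvgr_gt _ F1); rewrite ltrBlDr ltrDl invr_gt0.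
exists (Num.max 0 (B0 + 1)) => x; rewrite ge_max => /andP[x_ge0 xB].
have {}HB0 : 1 - N1%:R^-1 < F x by apply: HB0; lra.
have Fbar_gt0 : 0 < Fbar F x by rewrite subr_gt0.
(* With this [N], [Fbar F x] lies between [N.+1%:R^-1] and [N%:R^-1], so that [U N <= x]. *)
pose N := Num.truncn (Fbar F x)^-1.
have N1N : (N1 <= N)%N.
  rewrite /N truncn_ge_nat ?invr_ge0 ?(ltW Fbar_gt0)//.
  rewrite -[N1%:R]invrK lef_pV2 ?posrE ?invr_gt0//.
  by rewrite /Fbar; lra.
have /andP[NF FN] : N%:R <= (Fbar F x)^-1 < N.+1%:R.
  by apply: truncn_itv; rewrite invr_ge0 ltW.
have [N_ge2 N_geN0] : (2 <= N)%N /\ (N0 <= N)%N.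
  by split; apply: leq_trans N1N; rewrite !leq_max leqnn ?orbT.
have N_gt0 : 0 < N%:R :> R by rewrite ltr0n (leq_trans _ N_ge2).
have N_tau : 2 * tau' / (1 - tau') <= N%:R.
  have : ((Num.truncn (2 * tau' / (1 - tau'))).+1 <= N)%N.
    by apply: leq_trans N1N; rewrite !leq_max leqnn ?orbT.
  rewrite -(ler_nat R); apply: le_trans; apply/ltW/truncnS_gt.
have [HN1 HN2] := HN0 _ N_geN0.
have U_le : Uq F N%:R <= x.
  (* The set is bounded below since [N >= 2] makes [1 - N%:R^-1] positive, while [F] is 0 on
     negative reals. *)
  apply: ge_inf.
    exists 0 => y /= Fy; rewrite leNgt; apply/negP => /Fneg Fy0.
    by move: Fy; rewrite Fy0 subr_le0 invf_ge1// lern1 leqNgt N_ge2.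
  rewrite /= lerBlDr -lerBlDl -[_ - _]/(Fbar F x).
  by rewrite -[Fbar F x]invrK lef_pV2 ?posrE// invr_gt0.
have A_le : A N <= 2 * gamma * Uq F N%:R.
  have : 0 <= A N * - (2 * gamma)^-1 + Uq F N%:R.
    rewrite leNgt; apply/negP => /Fneg Fz; move: HN2.
    by rewrite Fz expr0n gtn_eqF ?(leq_trans _ N_ge2)// ltxx.
  rewrite mulrN addrC subr_ge0 ler_pdivrMr ?mulr_gt0//.
  by rewrite mulrC.
have arg_le : A N * 1 + Uq F N%:R <= (1 + 2 * gamma) * x.
  rewrite mulr1; apply: (@le_trans _ _ ((1 + 2 * gamma) * Uq F N%:R)).
    by rewrite mulrDl mul1r addrC lerD2l.
  by rewrite ler_pM2l//; lra.
have Fy : 1 - tau' / N%:R <= F (A N * 1 + Uq F N%:R).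
  apply: (@le_trans _ _ (expR (- (tau' / N%:R)))); first exact: expR_ge1Dx.
  rewrite leNgt; apply/negP => Flt; move: HN1.
  rewrite ltNge => /negP; apply.
  apply: (@le_trans _ _ (expR (- (tau' / N%:R)) ^+ N)).
    by apply: lerXn2r; rewrite ?nnegrE ?F_ge0 ?expR_ge0 ?ltW.
  by rewrite -expRM_natr mulNr divfK ?gt_eqF.
have {}Fy : Fbar F ((1 + 2 * gamma) * x) <= tau' / N%:R.
  by rewrite /Fbar; have := Fhomo _ _ arg_le; lra.
apply: le_trans Fy _.
have FbarN : N.+1%:R^-1 < Fbar F x.
  by rewrite -[Fbar F x]invrK ltf_pV2 ?posrE ?invr_gt0// ltr0n.
have q_gt0 : 0 < q by rewrite /q /tau'; lra.
apply: (@le_trans _ _ (q * N.+1%:R^-1)); last by rewrite ler_pM2l// ltW.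
rewrite ler_pdivrMr// mulrAC ler_pdivlMr ?ltr0n// -natr1.
move: N_tau; rewrite ler_pdivrMr; last by rewrite /tau'; lra.
rewrite /q; set t := tau'; set M := N%:R.
lra.
Qed.

(** * The size of [f] at a given point and the growth of [m n] *)

(** Between [x] and [lam * x] the tail loses at least [(1 - q) * Fbar F x], spread over integer
    steps of at most [f a.+1] each. Rounding both ends outwards costs less than 2 steps, which
    [2 <= x] absorbs. *)
Lemma envelope_value_ge (R : realType) (f : nat -> R) (F : R -> R)
    (q lam x : R) (a := Num.truncn x) :
  envelope_fun f -> {homo F : x y / x <= y} -> (forall k, F k%:R = envF f k) ->
  (forall j, (a < j)%N -> f j.+1 <= f j) ->
  1 <= lam -> 2 <= x -> Fbar F (lam * x) <= q * Fbar F x ->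
  (1 - q) * Fbar F x <= lam * x * f a.+1.
Proof.
move=> env Fhomo FE mono lam1 x2 Fq.
have x0 : 0 <= x by lra.
have lx : x <= lam * x by rewrite ler_peMl.
have /andP[ax xa] := truncn_itv x0.
have /andP[bx xb] := truncn_itv (le_trans x0 lx).
set b := Num.truncn (lam * x) in bx xb.
have ab : (a <= b.+1)%N.
  by rewrite -(ler_nat R); apply: le_trans ax _; lra.
have := envF_increment_le env ab mono; rewrite -!FE.
have Fa := Fhomo _ _ ax; have Fb := Fhomo _ _ (ltW xb).
have fa : 0 <= f a.+1 by have /andP[/ltW] := env.1 a.+1 isT.
have : (b.+1 - a)%:R * f a.+1 <= lam * x * f a.+1.
  apply: ler_wpM2r => //; rewrite natrB// -natr1; move: xa; rewrite -natr1 -/a.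
  lra.
move: Fq; rewrite /Fbar; lra.
Qed.

(** If [m n < B], then [m n = n * Fbar F (m n) >= n * Fbar F B], which exceeds [B] for large [n] as
    [Fbar F B > 0]. *)
Lemma root_tendsto_infty (R : realType) (F : R -> R) (m : nat -> R) (B : R) :
  {homo F : x y / x <= y} -> (forall x, F x < 1) ->
  (forall n, (0 < n)%N -> Fbar F (m n) = m n / n%:R) ->
  exists N, forall n, (N <= n)%N -> B <= m n.
Proof.
move=> Fhomo Flt1 mE.
have FB : 0 < Fbar F B by rewrite subr_gt0.
exists (Num.truncn (B / Fbar F B)).+1 => n Nn.
have n0 : 0 < n%:R :> R by rewrite ltr0n; apply: leq_trans Nn.
rewrite leNgt; apply/negP => mB.
have : Fbar F B <= m n / n%:R.
  by rewrite -mE ?(leq_trans _ Nn)// lerB// Fhomo// ltW.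
rewrite ler_pdivlMr// => /le_lt_trans/(_ mB).
rewrite mulrC -ltr_pdivlMr// ltNge => /negP; apply.
by apply: le_trans (ltW (truncnS_gt _)) _; rewrite ler_nat.
Qed.

(** * Choice of the constants and of the block of symbols *)

Theorem theorem5 (R : realType) (gamma : R) (hgamma : 0 < gamma) :
  exists kappa : R, 0 < kappa /\
    forall (f : nat -> R) (F : R -> R) (m : nat -> R),
      envelope_fun f ->
      ultimately_nonincreasing f ->
      smoothed_envelope f F ->
      MDA gamma F ->
      (forall n : nat, (0 < n)%N -> Fbar F (m n) = m n / n%:R) ->
      exists N : nat, forall n : nat, (N <= n)%N ->
        ((kappa * m n)%:E <= minimax_redundancy f n)%E.
Proof.
have halves a K : (K <= a)%N -> [/\ (a - K)./2 <= a,
    K + (a - K)./2.*2 <= a & a <= K + (a - K)./2.*2 + 1]%N by split; lia.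
have [q /andP[q0 q1] contraction] := MDA_tail_contraction hgamma.
pose lam := 1 + 2 * gamma; pose c := (1 - q) / lam.
have lam1 : 1 <= lam by rewrite /lam; lra.
have lam0 : 0 < lam by lra.
have c0 : 0 < c by rewrite divr_gt0//; lra.
have c1 : c <= 1 by rewrite ler_pdivrMr//; lra.
have ec : expR (- c) < 1 by rewrite expR_lt1; lra.
exists ((1 - expR (- c)) / 4); split; first by lra.
move=> f F m env [J mono] [Fneg [Fhomo [_ [F1 [FE _]]]]] mda mE.
have Flt1 x : F x < 1.
  apply: (@le_lt_trans _ _ (F (Num.truncn `|x|).+1%:R)).
    by apply: Fhomo; apply: le_trans (ler_norm _) _; exact/ltW/truncnS_gt.
  by rewrite FE envF_lt1.
have [B HB] := contraction F Fneg Fhomo Flt1 F1 mda.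
have [K0 HK0] := envelope_sum_ge1 env.
pose K := maxn J K0.
(* [2 * K + 4] is what [k >= m n / 4] requires, given [m n < a + 1] and [a <= K + 2 * k + 1]. *)
have [N HN] := root_tendsto_infty (Num.max B (2 * K%:R + 4)) Fhomo Flt1 mE.
exists (maxn 1 N) => n; rewrite geq_max => /andP[n_gt0 Nn].
have := HN n Nn; rewrite ge_max => /andP[mB mK].
have n0 : 0 < n%:R :> R by rewrite ltr0n.
have K_ge0 : 0 <= K%:R :> R by [].
have m2 : 2 <= m n by lra.
have m0 : 0 <= m n by lra.
pose a := Num.truncn (m n).
have /andP[am ma] : a%:R <= m n < a.+1%:R by exact: truncn_itv.
have Ka : (K <= a)%N by rewrite -ltnS -(ltr_nat R); apply: le_lt_trans ma; lra.
have JK : (J <= K)%N by rewrite leq_maxl.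
have mono_a j : (a < j)%N -> f j.+1 <= f j.
  by move=> aj; apply: mono; rewrite (leq_trans JK)// (leq_trans Ka)// ltnW.
(* Since [Fbar F (m n) = m n / n], the factor [m n] cancels from both sides. *)
have f_a : c / n%:R <= f a.+1.
  have := envelope_value_ge env Fhomo FE mono_a lam1 m2 (HB _ mB).
  rewrite mE// mulrCA [lam * m n]mulrC -mulrA ler_pM2l; last lra.
  by rewrite /c mulrAC !ler_pdivrMr// [f _ * lam]mulrC.
have f_j j : (K <= j <= a.+1)%N -> c / n%:R <= f j.
  move=> /andP[Kj ja]; apply: le_trans f_a _.
  rewrite -(subnKC ja); elim: (a.+1 - j)%N => [|d IHd]; first by rewrite addn0.
  apply: le_trans IHd; rewrite addnS; apply: mono.
  by rewrite (leq_trans JK)// (leq_trans Kj)// leq_addr.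
have {halves} := halves a K Ka; set k := (a - K)./2 => -[k_a Kk_a a_Kk].
have k_le : k%:R <= m n.
  by apply: le_trans am; rewrite ler_nat.
have k_ge : m n / 4 <= k%:R.
  move: a_Kk; rewrite -(ler_nat R) !natrD -muln2 natrM.
  by move: ma; rewrite -natr1; lra.
have w0 : 0 <= c / n%:R by rewrite divr_ge0// ltW.
have w1 : c / n%:R <= 1.
  by rewrite ler_pdivrMr// mul1r (le_trans c1)// ler1n.
apply: le_trans (@minimax_redundancy_ge_block _ f K k n (c / n%:R) _ _ w0 _ _).
- rewrite lee_fin [leLHS](_ : _ = m n / 4 * (1 - expR (- c))); last by ring.
  apply: ler_pM => //; [lra|lra|rewrite lerD2l lerN2].
  (* This reduces [(1 - c / n) ^+ n <= expR (- c)] to the inequality [1 + y <= expR y]. *)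
  have -> : expR (- c) = expR (- (c / n%:R)) ^+ n.
    by rewrite -expRM_natr mulNr divfK ?gt_eqF.
  by apply: lerXn2r; rewrite ?nnegrE ?expR_ge0 ?expR_ge1Dx ?subr_ge0.
- by move=> j /env.1/andP[/ltW].
- by apply: HK0; rewrite leq_maxr.
(* The pairs weigh at most [m n * (c / n) = c * Fbar F (m n) <= 1]. *)
- apply: (@le_trans _ _ (m n * (c / n%:R))); first exact: ler_wpM2r.
  have F0 : 0 <= F (m n) by rewrite -(Fneg (-1) (ltrN10 _)) Fhomo//; lra.
  have Fbar0 : 0 <= Fbar F (m n) by rewrite subr_ge0 ltW.
  rewrite mulrCA -mE//; apply: (@le_trans _ _ (1 * Fbar F (m n))).
    exact: ler_wpM2r.
  by rewrite mul1r gerBl.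
- move=> j /andP[Kj jk]; apply: f_j; rewrite ltnW//=.
  by rewrite ltnW// ltnS (leq_trans jk).
Qed.
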